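(* Let $X$ be an infinite-dimensional complex Banach space, $\lambda\in\mathbb{C}$, $T\in L(X)$, $d\in\mathbb{N}_0$, and let $T-\lambda I$ have TUD for $n\ge d$. Then the following statements are equivalent: (1) $\sigma_{cp}(T)$ does not cluster at $\lambda$; (2) $\lambda$ is not an interior point of $\sigma_{cp}(T)$; (3) $\sigma_{\mathcal{B}_-}(T)$ does not cluster at $\lambda$; (4) $\lambda$ is not an interior point of $\sigma_{\mathcal{B}_-}(T)$; (5) $\sigma_{RD}(T)$ does not cluster at $\lambda$; (6) $\lambda$ is not an interior point of $\sigma_{RD}(T)$; (7) $\sigma_{dsc}(T)$ does not cluster at $\lambda$; (8) $\lambda$ is not an interior point of $\sigma_{dsc}(T)$; (9) $\delta(T-\lambda I)<\infty$. In particular, if $T-\lambda I$ is quasi-Fredholm, then the statements (1)-(9) are equivalent to the following statement: (10) $T-\lambda I$ is right Drazin invertible.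
   Context: $L(X)$ is the algebra of bounded linear operators on $X$; $N(T)$, $R(T)$ are the null space and range; $\mathbb{N}_0=\{0,1,2,\dots\}$. The compression spectrum $\sigma_{cp}(T)$ is the set of $\mu\in\mathbb{C}$ such that $T-\mu I$ does not have dense range. The descent is $\delta(T)=\inf\{n\in\mathbb{N}_0:R(T^n)=R(T^{n+1})\}$ ($\inf\emptyset=\infty$); $\sigma_{dsc}(T)=\{\mu\in\mathbb{C}:\delta(T-\mu I)=\infty\}$. $T$ is lower semi-Browder if $\operatorname{codim}R(T)<\infty$ and $\delta(T)<\infty$; $\sigma_{\mathcal{B}_-}(T)$ is the set of $\mu\in\mathbb{C}$ such that $T-\mu I$ is not lower semi-Browder. $T$ is right Drazin invertible if $\delta(T)<\infty$ and $R(T^{\delta(T)})$ is closed; $\sigma_{RD}(T)$ is the set of $\mu\in\mathbb{C}$ such that $T-\mu I$ is not right Drazin invertible. Let $k_n(T)=\dim (R(T^n)\cap N(T))/(R(T^{n+1})\cap N(T))$. $T$ is quasi-Fredholm if there is $m\in\mathbb{N}_0$ such that $k_n(T)=0$ for all $n\ge m$ and $R(T^{m+1})$ is closed. The operator range topology on $R(T^d)$ is given by the norm $\|y\|_d=\inf\{\|x\|:x\in X,\ y=T^dx\}$. $T$ has topological uniform descent (TUD) for $n\ge d$ if $k_n(T)=0$ for all $n\ge d$ and $R(T^n)$ is closed in the operator range topology of $R(T^d)$ for all $n\ge d$. A set $K\subset\mathbb{C}$ does not cluster at $\lambda$ if $\lambda$ is not an accumulation point of $K$; interior is taken in $\mathbb{C}$.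 *)

(* Defs.v *)
From HB Require Import structures.
From mathcomp Require Import all_boot all_order all_algebra.
From mathcomp Require Import complex.
From mathcomp Require Import all_classical all_reals all_analysis.

Set Implicit Arguments.
Unset Strict Implicit.
Unset Printing Implicit Defensive.

Import Order.TTheory GRing.Theory Num.Theory.
Import numFieldNormedType.Exports.

Local Open Scope classical_set_scope.
Local Open Scope ring_scope.

(* The complex numbers, with their usual topology: the numeric field [R[i]]
   seen as a normed module over itself. *)
Definition Cplx (R : realType) : normedModType R[i] := (R[i])^o.

Section SubspaceDimension.
Variables (R : realType) (X : lmodType R[i]).

Definition indep_mod (B : set X) (n : nat) (v : 'I_n -> X) : Prop :=
  forall c : 'I_n -> R[i], B (\sum_(i < n) c i *: v i) -> forall i, c i = 0.

(* [dim_quot A B] is the dimension of the quotient of the subspace [A] by its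
   subspace [B]: the largest number of elements of [A] that are linearly
   independent modulo [B], and [+oo] if there is no largest one. *)
Definition dim_quot (A B : set X) : \bar R :=
  ereal_sup [set n%:R%:E | n in
    [set n : nat | exists v : 'I_n -> X, (forall i, A (v i)) /\ indep_mod B v]].

Definition codim (B : set X) : \bar R := dim_quot setT B.

Definition infinite_dimensional : Prop := dim_quot (setT : set X) [set 0] = +oo%E.

End SubspaceDimension.

Arguments infinite_dimensional {R} X.

Section Operators.
Variables (R : realType) (X : normedModType R[i]).
Implicit Types (S T : {linear X -> X}) (mu : Cplx R) (n d : nat).

Definition null_space S : set X := [set x | S x = 0].

Definition range_pow S n : set X := range (iter n S).

Definition op_sub T mu : {linear X -> X} := T \- mu \*: idfun.

Definition descent S : \bar R :=
  ereal_inf [set n%:R%:E | n in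
    [set n : nat | range_pow S n = range_pow S n.+1]].

Definition lower_semi_Browder S : Prop :=
  (codim (range S) < +oo)%E /\ (descent S < +oo)%E.

(* The equation forces the descent to be finite, with value [n]. *)
Definition right_Drazin_invertible S : Prop :=
  exists n : nat, descent S = n%:R%:E /\ closed (range_pow S n).

Definition sigma_cp T : set (Cplx R) :=
  [set mu | ~ dense (range (op_sub T mu))].

Definition sigma_dsc T : set (Cplx R) :=
  [set mu | descent (op_sub T mu) = +oo%E].

Definition sigma_Bminus T : set (Cplx R) :=
  [set mu | ~ lower_semi_Browder (op_sub T mu)].

Definition sigma_RD T : set (Cplx R) :=
  [set mu | ~ right_Drazin_invertible (op_sub T mu)].

Definition k_ S n : \bar R :=
  dim_quot (range_pow S n `&` null_space S)
           (range_pow S n.+1 `&` null_space S).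

Definition quasi_Fredholm S : Prop :=
  exists m : nat, (forall n, (m <= n)%N -> k_ S n = 0%E) /\
    closed (range_pow S m.+1).

(* [`|x|] is a nonnegative real element of [R[i]], hence the real part. *)
Definition op_range_norm S d (y : X) : R :=
  inf [set complex.Re `|x| | x in [set x : X | y = iter d S x]].

(* [A] is closed in the operator range topology of [range_pow S d]: its
   complement in [range_pow S d] is open for [op_range_norm S d]. *)
Definition op_range_closed S d (A : set X) : Prop :=
  forall y, range_pow S d y -> ~ A y ->
    exists2 e : R, 0 < e & forall z, range_pow S d z ->
      op_range_norm S d (z - y) < e -> ~ A z.

(* Topological uniform descent for n >= d *)
Definition TUD S d : Prop :=
  forall n, (d <= n)%N ->
    k_ S n = 0%E /\ op_range_closed S d (range_pow S n).

End Operators.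

(* Main.v *)
Require Import Defs.
From mathcomp Require Import all_boot all_order all_algebra.
From mathcomp Require Import complex.
From mathcomp Require Import all_classical all_reals all_analysis.
From mathcomp Require Import lra ring.

Import Order.TTheory GRing.Theory Num.Theory.
Import numFieldNormedType.Exports.

Local Open Scope classical_set_scope.
Local Open Scope ring_scope.

(** Write S = T - lambda and let Y = R(S^d) carry the operator range norm, so
that Y is the Banach space X / N(S^d).  Topological uniform descent says that
the operator A induced by S on Y has closed range and satisfies
N(A) <= R(A^n) for every n: it is semi-regular.  Finite descent of S means
that A is onto, and S - mu is onto X exactly when A - mu is onto Y for
mu <> 0, because z^d and z - mu are coprime polynomials.  The equivalence thus
reduces to three facts about small mu, in terms of the hyperrange, the
intersection of all R(A^n).

- The open mapping theorem lifts elements of R(A) with norm control, and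
  N(A) <= R(A^n) makes every A-preimage of an element of the hyperrange stay
  in the hyperrange.  Iterating the lifting solves (A - mu) u = x for every x
  in the hyperrange, with |u| <= 2C|x| ([solve_hyperrange_preim]).  If S has
  finite descent the hyperrange is all of Y, so S - mu is onto X for small
  mu <> 0 ([onto_of_hyperrange_full]), and lambda is then isolated from all
  four spectra.

- Elements of N(A) lie in the hyperrange, and the previous point perturbs each
  of them to an element of N(A - mu).  Subtracting such elements gives a lower
  bound for A - mu modulo its kernel which is uniform in mu
  ([preimage_bound]).  If A - mu has dense range for mu arbitrarily close to
  0, then y is close to some (A - mu) u = A u - mu u with u bounded
  independently of mu; letting mu tend to 0 puts y in the closure of R(A),
  which is R(A) ([onto_of_dense]).  This handles the compression spectrum.

- If A - mu has finite descent n with mu <> 0, then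
  Y = R(A - mu) + N((A - mu)^n), and N((A - mu)^n) lies in the hyperrange, hence
  in R(A - mu) by the first point.  So A - mu is onto
  ([onto_mod_of_descent]) and the second point applies.  The other two spectra
  contain the descent spectrum.

The quotient Y is never built: a statement about Y becomes a statement about
X modulo the closed subspace N(S^d), an equation S^d x = S^d y standing for
equality in Y.  In the quasi-Fredholm case R(S^(m+1)) is closed for some m
beyond which the k_n vanish, and a finite descent n forces n <= m and
R(S^n) = R(S^(m+1)), which is right Drazin invertibility. *)

(** * The norm as a real number *)

Section RealNorm.
Context {R : realType} {V : normedZmodType R[i]}.
Implicit Types x y : V.

(** The norm of a complex space takes values in [R[i]], which is only partially
ordered; its real part makes estimates accessible to [lra] and [nra]. *)
Definition rnorm x : R := complex.Re `|x|.

Lemma rnormE x : (rnorm x)%:C%C = `|x|.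
Proof. by rewrite /rnorm RRe_real ?normr_real. Qed.

Lemma rnorm_ge0 x : 0 <= rnorm x.
Proof. by rewrite -ler0c rnormE normr_ge0. Qed.

Lemma rnorm0 : rnorm (0 : V) = 0.
Proof. by rewrite /rnorm normr0. Qed.

Lemma rnorm_le0 x : rnorm x <= 0 -> x = 0.
Proof. by rewrite -lecR rnormE => x0; apply/eqP; rewrite -normr_le0. Qed.

Lemma rnorm_gt0 x : x != 0 -> 0 < rnorm x.
Proof. by move=> x0; rewrite ltNge; apply/negP => /rnorm_le0/eqP; apply/negP. Qed.

Lemma rnormD x y : rnorm (x + y) <= rnorm x + rnorm y.
Proof. by rewrite -lecR rmorphD /= !rnormE ler_normD. Qed.

Lemma rnormN x : rnorm (- x) = rnorm x.
Proof. by rewrite /rnorm normrN. Qed.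

Lemma rnormB x y : rnorm (x - y) <= rnorm x + rnorm y.
Proof. by rewrite -(rnormN y) rnormD. Qed.

Lemma rdistC x y : rnorm (x - y) = rnorm (y - x).
Proof. by rewrite /rnorm distrC. Qed.

Lemma rdist_triangle z x y : rnorm (x - y) <= rnorm (x - z) + rnorm (z - y).
Proof. by rewrite (le_trans _ (rnormD _ _))// addrA subrK. Qed.

End RealNorm.

Section RealNormTopology.
Context {R : realType} {V : normedModType R[i]}.

Lemma rnormZ (a : R[i]) (x : V) : rnorm (a *: x) = rnorm a * rnorm x.
Proof. by apply: (@complexI R); rewrite rmorphM /= !rnormE normrZ. Qed.

Lemma rnorm_real (r : R) : 0 <= r -> rnorm (r%:C%C : R[i]) = r.
Proof. by move=> r0; rewrite /rnorm ger0_norm// ler0c. Qed.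

Lemma nbhs_rnorm (x : V) (A : set V) :
  nbhs x A <-> exists2 e : R, 0 < e & forall y, rnorm (y - x) < e -> A y.
Proof.
split => [/nbhs_ballP [e /= e0 xA]|[e e0 xA]].
  have eE : (complex.Re e)%:C%C = e by rewrite RRe_real// gtr0_real.
  exists (complex.Re e); first by rewrite -ltcR eE.
  move=> y yx; apply: xA; rewrite -ball_normE /= distrC.
  by rewrite -rnormE -eE ltcR.
apply/nbhs_ballP; exists e%:C%C; first by rewrite /= ltcR.
by move=> y; rewrite -ball_normE /= distrC -rnormE ltcR; exact: xA.
Qed.

Lemma closed_rnorm (A : set V) : closed A <->
  forall x, (forall e : R, 0 < e -> exists2 a, A a & rnorm (x - a) < e) -> A x.
Proof.
split=> [cA x xA|xA x clx].
  apply: cA => B /nbhs_rnorm [e e0 eB]; have [a Aa ax] := xA e e0.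
  by exists a; split => //; apply: eB; rewrite rdistC.
apply: xA => e e0.
have /clx [a [Aa /= ax]] : nbhs x [set y | rnorm (y - x) < e].
  by apply/nbhs_rnorm; exists e.
by exists a; rewrite // rdistC.
Qed.

Lemma dense_rnorm (A : set V) : dense A <->
  forall (x : V) (e : R), 0 < e -> exists2 a, A a & rnorm (x - a) < e.
Proof.
split=> [dA x e e0|dA O [x Ox] oO].
  have xe : nbhs x [set y | rnorm (y - x) < e] by apply/nbhs_rnorm; exists e.
  have [||a [/interior_subset /= ax Aa]] :=
    dA (interior [set y | rnorm (y - x) < e]).
  - by exists x.
  - exact: open_interior.
  - by exists a; rewrite // rdistC.
have /nbhs_rnorm [e e0 eO] : nbhs x O by exact: open_nbhs_nbhs.
by have [a Aa xa] := dA x e e0; exists a; split => //; apply: eO; rewrite rdistC.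
Qed.

End RealNormTopology.

(** * Completeness and bounded operators *)

Section Completeness.
Context {R : realType}.
Implicit Types (a b e : R).

Lemma half_pow_small b e : 0 < e -> exists n, b * 2^-1 ^+ n < e.
Proof.
move=> e0; have [b0|b0] := leP b 0.
  by exists 0; rewrite expr0 mulr1; lra.
exists (Num.bound (b / e)); rewrite exprVn ltr_pdivrMr ?exprn_gt0//.
rewrite mulrC -ltr_pdivrMr//.
apply: (lt_trans (archi_boundP _)); first by rewrite divr_ge0// ltW.
by rewrite -natrX ltr_nat ltn_expl.
Qed.

Lemma geometric_cauchy {X : completeNormedModType R[i]} (x : nat -> X) a :
  (forall n, rnorm (x n.+1 - x n) <= a * 2^-1 ^+ n) ->
  exists l, forall n, rnorm (l - x n) <= 2 * a * 2^-1 ^+ n.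
Proof.
move=> xS; have a0 : 0 <= a.
  by have := xS 0; rewrite expr0 mulr1; exact/le_trans/rnorm_ge0.
have xD n m : rnorm (x (n + m)%N - x n) <= 2 * a * 2^-1 ^+ n.
  suff : rnorm (x (n + m)%N - x n) <= 2 * a * (2^-1 ^+ n - 2^-1 ^+ (n + m)).
    move/le_trans; apply; rewrite ler_wpM2l//; first lra.
    by rewrite gerBl exprn_ge0.
  elim: m => [|m IH]; first by rewrite addn0 !subrr rnorm0 mulr0.
  have := xS (n + m)%N; have := rdist_triangle (x (n + m)%N) (x (n + m.+1)%N) (x n).
  rewrite addnS (exprS _ (n + m)%N) => h1 h2.
  by apply: (le_trans h1); nra.
have : cvg (x @ \oo).
  apply: cauchy_cvg; apply: cauchy_exP => e e0.
  have eE : (complex.Re e)%:C%C = e by rewrite RRe_real// gtr0_real.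
  have [|n ne] := half_pow_small (2 * a) (complex.Re e).
    by rewrite -ltcR eE.
  exists (x n); exists n => // m /= nm; rewrite -ball_normE /= distrC -rnormE.
  by rewrite -eE ltcR -(subnKC nm); apply: le_lt_trans ne.
rewrite cvg_ex => -[l xl]; exists l => n; apply/ler_addgt0Pr => e e0.
have : nbhs l [set y | rnorm (y - l) < e] by apply/nbhs_rnorm; exists e.
move/xl => -[N _ Ne].
have /= := Ne (n + N)%N (leq_addl _ _); have := xD n N.
have := rdist_triangle (x (n + N)%N) l (x n); rewrite (rdistC l (x (n + N)%N)).
lra.
Qed.

End Completeness.

Section Bounded.
Context {R : realType} {X : normedModType R[i]}.

Definition bounded_by (S : X -> X) (L : R) := forall x, rnorm (S x) <= L * rnorm x.

Lemma continuous_bounded_by (S : {linear X -> X}) :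
  continuous S -> exists2 L, 0 <= L & bounded_by S L.
Proof.
move=> /linear_bounded_continuous /linear_boundedP.
move=> /pinfty_ex_gt0 [M M0 SM].
have ME : (complex.Re M)%:C%C = M by rewrite RRe_real// gtr0_real.
exists (complex.Re M); first by rewrite ltW// -ltcR ME.
by move=> x; rewrite -lecR rmorphM /= ME !rnormE.
Qed.

Lemma bounded_by_iter (S : {linear X -> X}) L n : 0 <= L -> bounded_by S L ->
  bounded_by (iter n S) (L ^+ n).
Proof.
move=> L0 SL x; elim: n => [|n IH]; first by rewrite expr0 mul1r.
by rewrite exprS -mulrA; apply: (le_trans (SL _)); rewrite ler_wpM2l.
Qed.

Lemma bounded_by_op_sub (S : {linear X -> X}) L (mu : R[i]) :
  bounded_by S L -> bounded_by (op_sub S mu) (L + rnorm mu).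
Proof.
move=> SL x; rewrite mulrDl -rnormZ; apply: (le_trans (rnormB _ _)).
by rewrite lerD2r.
Qed.

End Bounded.

(** * Linear subspaces *)

Section Subspaces.
Context {R : realType} {X : lmodType R[i]}.
Implicit Types x y : X.

Definition is_subspace (A : set X) :=
  A 0 /\ forall (a : R[i]) x y, A x -> A y -> A (a *: x + y).

Lemma is_subspaceD A x y : is_subspace A -> A x -> A y -> A (x + y).
Proof. by move=> [_ Al] Ax Ay; rewrite -[x]scale1r; exact: Al. Qed.

Lemma is_subspaceZ A (a : R[i]) x : is_subspace A -> A x -> A (a *: x).
Proof. by move=> [A0 Al] Ax; rewrite -[_ *: _]addr0; exact: Al. Qed.

Lemma is_subspaceB A x y : is_subspace A -> A x -> A y -> A (x - y).
Proof.
move=> sA Ax Ay; rewrite -scaleN1r; apply: is_subspaceD => //.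
exact: is_subspaceZ.
Qed.

End Subspaces.

(** * Category argument and open mapping modulo a subspace *)

Section OpenMapping.
Context {R : realType} {X : completeNormedModType R[i]}.
Implicit Types (x y u : X) (Q M : set X).

(** Baire's theorem inside a closed subset [M] of a Banach space.  If no [closure (E k)] contained a ball of [M], one could
choose nested balls, the k-th avoiding [E k], and their common point would
lie in [M] but in no [E k]. *)
Lemma closed_cover_ball M (E : nat -> set X) : closed M -> M 0 ->
  (forall x, M x -> exists k, E k x) ->
  exists k x0, exists2 r : R, 0 < r & M x0 /\
    forall x, M x -> rnorm (x - x0) < r -> closure (E k) x.
Proof.
move=> /closed_rnorm cM M0 cov; apply: contrapT => nex.
have step (p : nat * (X * R)) : exists q : X * R,
    M p.2.1 -> 0 < p.2.2 ->
    [/\ M q.1, 0 < q.2, rnorm (q.1 - p.2.1) <= p.2.2, q.2 <= p.2.2 / 2 &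
        forall a, E p.1 a -> 4 * q.2 <= rnorm (q.1 - a)].
  case: p => k [x0 r] /=.
  have [Mx0|] := pselect (M x0); last by exists (0, 0).
  have [r0|] := pselect (0 < r); last by exists (0, 0).
  have [x [Mx xx0 nclx]] : exists x,
      [/\ M x, rnorm (x - x0) < r & ~ closure (E k) x].
    apply: contrapT => nx; apply: nex; exists k, x0, r => //; split=> // x Mx xx0.
    by apply: contrapT => nclx; apply: nx; exists x.
  have [s s0 Es] : exists2 s : R, 0 < s & forall a, E k a -> s <= rnorm (x - a).
    apply: contrapT => ns; apply: nclx => B /nbhs_rnorm [e e0 eB].
    apply: contrapT => EB; apply: ns; exists e => // a Ea.
    rewrite leNgt; apply/negP => xa; apply: EB; exists a; split => //.
    by apply: eB; rewrite rdistC.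
  (* The limit will lie within twice the new radius of [x], so the bound
     [s / 4] keeps it off [E k]; halving makes the centres Cauchy. *)
  exists (x, Num.min (r / 2) (s / 4)) => _ _; split => //=.
  - by rewrite lt_min !divr_gt0.
  - exact: ltW.
  - by rewrite ge_min lexx.
  - move=> a /Es; apply: le_trans.
    have : Num.min (r / 2) (s / 4) <= s / 4 by rewrite ge_min lexx orbT.
    lra.
have [f Pf] := choice step.
pose fix p n := if n is m.+1 then f (m, p m) else (0 : X, 1 : R).
have pP n : M (p n).1 /\ 0 < (p n).2.
  elim: n => [|n [Mp p0]] /=; first by split.
  by have [] := Pf (n, p n) Mp p0.
have {}Pf n := Pf (n, p n) (pP n).1 (pP n).2.
have [|l pl] := geometric_cauchy (fun n => (p n).1) 1.
  move=> n; rewrite mul1r; have [_ _ h _ _] := Pf n; apply: (le_trans h) => /=.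
  elim: n {h} => [|n IH] //=; have [_ _ _ /= h _] := Pf n.
  by rewrite exprS; lra.
have {}pl n : rnorm (l - (p n).1) <= 2 * (p n).2.
  have pD m : rnorm ((p (n + m)%N).1 - (p n).1) <= 2 * (p n).2 - 2 * (p (n + m)%N).2.
    elim: m => [|m IH]; first by rewrite addn0 !subrr rnorm0.
    have [_ _ /= h1 /= h2 _] := Pf (n + m)%N.
    have := rdist_triangle (p (n + m)%N).1 (p (n + m.+1)%N).1 (p n).1.
    by rewrite addnS /=; lra.
  apply/ler_addgt0Pr => e e0; have [N Ne] := half_pow_small (2 * 1) e e0.
  have := pl (n + N)%N; have := pD N; have [_] := pP (n + N)%N.
  have := rdist_triangle (p (n + N)%N).1 l (p n).1.
  have : (2^-1 : R) ^+ (n + N) <= 2^-1 ^+ N.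
    rewrite exprD ler_piMl ?exprn_ge0 ?invr_ge0//.
    by apply: exprn_ile1; [rewrite invr_ge0|rewrite invf_le1// ler1n].
  by lra.
have Ml : M l.
  apply: cM => e e0; have [N Ne] := half_pow_small 2 e e0.
  exists (p N).1; first exact: (pP N).1.
  apply: le_lt_trans (pl N) (le_lt_trans _ Ne); rewrite ler_pM2l//.
  elim: {Ne} N => [|n IH] //=; have [_ _ _ /= h _] := Pf n.
  by rewrite exprS; lra.
have [k Ekl] := cov l Ml.
have [_ + _ _ /(_ l Ekl)] := Pf k; have := pl k.+1; rewrite /= rdistC; lra.
Qed.

(** If every x of G is solved up to an error in G of half its size, then the
errors tend to 0 and the sum of the corrections solves x exactly.  Working
modulo [Q] makes this a statement about the quotient by [Q]; it is used both
for the second half of the open mapping theorem and as a Neumann series. *)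
Lemma successive_approximation (F : {linear X -> X}) (L C : R) (G Q : set X) :
  0 <= L -> bounded_by F L -> 0 <= C -> closed Q -> is_subspace Q ->
  (forall x, G x -> exists u r, [/\ G r, Q (x - r - F u),
     rnorm u <= C * rnorm x & rnorm r <= rnorm x / 2]) ->
  forall x, G x -> exists2 u, Q (x - F u) & rnorm u <= 2 * C * rnorm x.
Proof.
move=> L0 FL C0 /closed_rnorm cQ sQ H x Gx.
have /choice[f Pf] : forall y, exists ur : X * X, G y -> [/\ G ur.2,
    Q (y - ur.2 - F ur.1), rnorm ur.1 <= C * rnorm y & rnorm ur.2 <= rnorm y / 2].
  move=> y; have [/H[u [r Gy]]|] := pselect (G y); last by exists (0, 0).
  by exists (u, r).
pose r n := iter n (fun y => (f y).2) x.
pose u n := (f (r n)).1.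
have Gr n : G (r n) by elim: n => // n /Pf[].
have rE n : rnorm (r n) <= rnorm x * 2^-1 ^+ n.
  elim: n => [|n IH]; first by rewrite expr0 mulr1.
  by have [_ _ _ h] := Pf _ (Gr n); rewrite exprS /=; lra.
have uE n : rnorm (u n) <= C * rnorm x * 2^-1 ^+ n.
  have [_ _ h _] := Pf _ (Gr n); apply: (le_trans h).
  by rewrite -mulrA ler_wpM2l.
pose U n := \sum_(j < n) u j.
have QU n : Q (x - r n - F (U n)).
  elim: n => [|n IH]; first by rewrite /U big_ord0 linear0 subrr subr0; case: sQ.
  rewrite /U big_ord_recr /= linearD.
  have [_ h _ _] := Pf _ (Gr n); have := is_subspaceD _ _ _ sQ IH h.
  rewrite -/(u n) -/(U n) (addrAC x) -[r n - _ - _]addrA subrKA !addrA.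
  by rewrite (addrAC x) opprD addrA.
have [|l lU] := geometric_cauchy U (C * rnorm x).
  by move=> n; rewrite /U big_ord_recr /= addrAC subrr add0r.
exists l; last by have := lU 0; rewrite /U big_ord0 subr0 expr0 mulr1 mulrA.
apply: cQ => e e0.
have [n ne] := half_pow_small (rnorm x + L * (2 * (C * rnorm x))) e e0.
exists (x - r n - F (U n)) => //.
have -> : x - F l - (x - r n - F (U n)) = r n - F (l - U n).
  by rewrite (linearB F) !opprB [LHS]addrC (addrA (F (U n))) subrKA addrA (addrC (r n)).
apply: le_lt_trans ne; apply: (le_trans (rnormB _ _)); rewrite mulrDl -mulrA.
by apply: lerD => //; apply: (le_trans (FL _)); rewrite ler_wpM2l.
Qed.

(** The open mapping theorem for the map induced by [F] into the quotient by
[Q], whose range has the preimage [set x | exists u, Q (x - F u)]: when this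
preimage is closed, it is covered by the images of the balls of radius k, one
of which is dense in a ball; differences and scaling carry this to the origin,
and successive approximation removes the closure. *)
Lemma open_mapping_mod (F : {linear X -> X}) (L : R) (Q : set X) :
  0 <= L -> bounded_by F L -> closed Q -> is_subspace Q ->
  closed [set x | exists u, Q (x - F u)] ->
  exists2 C : R, 0 <= C & forall x, (exists u, Q (x - F u)) ->
    exists2 u, Q (x - F u) & rnorm u <= C * rnorm x.
Proof.
move=> L0 FL cQ sQ; set M := [set x | _] => cM.
have sM : is_subspace M.
  split=> [|a x y [u xu] [v yv]].
    by exists 0; rewrite (linear0 F) subr0; case: sQ.
  exists (a *: u + v); have [_ Ql] := sQ; have := Ql a _ _ xu yv.
  by congr Q; rewrite (linearP F) scalerBr opprD addrACA.
have QM q : Q q -> M q by move=> Qq; exists 0; rewrite (linear0 F) subr0.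
have FM u : M (F u) by exists u; rewrite subrr; case: sQ.
pose E k := [set y | exists2 u, rnorm u <= k%:R & Q (y - F u)].
have [|x Mx|k [x0 [r r0 [Mx0 x0E]]]] := closed_cover_ball M E cM.
- by case: sM.
- have [u xu] := Mx; exists (Num.bound (rnorm u)); exists u => //.
  by rewrite ltW// archi_boundP// rnorm_ge0.
have {}x0E x e : M x -> rnorm (x - x0) < r -> 0 < e ->
    exists2 u, rnorm u <= k%:R & exists2 q, Q q & rnorm (x - q - F u) < e.
  move=> Mx xx0 e0.
  have /(x0E x Mx xx0) [a [[u uk au] /= ax]] : nbhs x [set y | rnorm (y - x) < e].
    by apply/nbhs_rnorm; exists e.
  by exists u => //; exists (a - F u) => //; rewrite opprB addrAC addrA subrK rdistC.
set r2 := r / 2; have r20 : 0 < r2 by rewrite divr_gt0.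
have appr x : M x -> exists u s, [/\ M s, Q (x - s - F u),
    rnorm u <= 4 * k%:R / r * rnorm x & rnorm s <= rnorm x / 2].
  move=> Mx; have [->|x_neq0] := eqVneq x 0.
    exists 0, 0; rewrite rnorm0 (linear0 F) mulr0 mul0r !subr0.
    by case: sQ => Q0 _; case: sM => M0 _.
  have x_gt0 := rnorm_gt0 _ x_neq0.
  (* [t *: x + x0] is at distance [r / 2] from [x0]; approximating both points
     to within [r / 8] leaves the error [rnorm x / 2] after division by [t]. *)
  set t := r / (2 * rnorm x); have t0 : 0 < t by rewrite divr_gt0// mulr_gt0.
  have tN : rnorm (t%:C%C : R[i]) = t by rewrite rnorm_real// ltW.
  have tC0 : t%:C%C != 0 :> R[i] by rewrite gt_eqF// ltcR.
  set a : R[i] := (t%:C%C)^-1.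
  have aN : rnorm a = t^-1.
    by rewrite /a -(fmorphV (real_complex R)) rnorm_real// invr_ge0 ltW.
  have r80 : 0 < r / 8 by rewrite divr_gt0.
  have Mtx : M (t%:C%C *: x + x0) by apply: is_subspaceD => //; exact: is_subspaceZ.
  have [|u1 u1k [q1 Qq1 s1]] := x0E _ _ Mtx _ r80.
    rewrite addrK rnormZ tN /t invfM mulrA divfK ?gt_eqF//; lra.
  have [|u2 u2k [q2 Qq2 s2]] := x0E _ _ Mx0 _ r80; first by rewrite subrr rnorm0.
  set u := a *: (u1 - u2); set q := a *: (q1 - q2).
  have Qq : Q q by apply: is_subspaceZ => //; exact: is_subspaceB.
  exists u, (x - q - F u); split.
  - by apply: is_subspaceB => //; apply: is_subspaceB => //; exact: QM.
  - by rewrite -[x - q - _]addrA opprD addNKr opprD !opprK addrK.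
  - rewrite /u rnormZ aN mulrC ler_pdivrMr//.
    rewrite (_ : _ * t = 2 * k%:R).
      by apply: (le_trans (rnormB _ _)); lra.
    by rewrite /t; field; rewrite !gt_eqF.
  - have -> : x - q - F u =
      a *: ((t%:C%C *: x + x0 - q1 - F u1) - (x0 - q2 - F u2)).
      have -> : t%:C%C *: x + x0 - q1 - F u1 - (x0 - q2 - F u2) =
          t%:C%C *: x - (q1 - q2) - F (u1 - u2).
        rewrite (linearB F) !opprD !opprK !addrA.
        by rewrite [LHS](ACl (2*5*1*3*6*4*7)) /= subrr add0r.
      by rewrite !scalerBr scalerA mulVf// scale1r -scalerBr -linearZ.
    rewrite rnormZ aN mulrC ler_pdivrMr// (_ : _ * t = r / 4).
      by apply: (le_trans (rnormB _ _)); lra.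
    by rewrite /t; field; rewrite !gt_eqF.
have C0 : 0 <= 4 * k%:R / r by rewrite divr_ge0 ?mulr_ge0// ltW.
exists (2 * (4 * k%:R / r)); first by rewrite mulr_ge0.
exact: successive_approximation L0 FL C0 cQ sQ appr.
Qed.


End OpenMapping.

(** * Ranges and kernels of powers *)

Section IteratedOperator.
Context {R : realType} {X : normedModType R[i]}.
Implicit Types (S : {linear X -> X}) (x y : X) (m n d : nat).

Lemma op_subE S (mu : R[i]) x : op_sub S mu x = S x - mu *: x.
Proof. by []. Qed.

Lemma iter_linear S n : linear (iter n S).
Proof. by elim: n => [|n IH] a x y //=; rewrite IH linearP. Qed.

Lemma iter_linear0 S n : iter n S 0 = 0.
Proof. by elim: n => [|n IH] //=; rewrite IH linear0. Qed.

Lemma iter_linearD S n x y : iter n S (x + y) = iter n S x + iter n S y.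
Proof. by rewrite -[x]scale1r iter_linear !scale1r. Qed.

Lemma iter_linearZ S n (a : R[i]) x : iter n S (a *: x) = a *: iter n S x.
Proof. by rewrite -[_ *: _]addr0 iter_linear iter_linear0 addr0. Qed.

Lemma iter_linearB S n x y : iter n S (x - y) = iter n S x - iter n S y.
Proof. by rewrite -scaleN1r iter_linearD iter_linearZ scaleN1r. Qed.

Lemma iter_comm S m n x : iter m S (iter n S x) = iter n S (iter m S x).
Proof. by rewrite -!iterD addnC. Qed.

Lemma range_powE S n x : range_pow S n x <-> exists w, x = iter n S w.
Proof. by split=> [[w _ <-]|[w ->]]; exists w. Qed.

Lemma range_pow_subspace S n : is_subspace (range_pow S n).
Proof.
split=> [|a x y]; first by apply/range_powE; exists 0; rewrite iter_linear0.
move=> /range_powE[u ->] /range_powE[v ->]; apply/range_powE.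
by exists (a *: u + v); rewrite iter_linear.
Qed.

Lemma range_pow_le S m n : (m <= n)%N -> range_pow S n `<=` range_pow S m.
Proof.
move=> mn x /range_powE[w ->]; apply/range_powE; exists (iter (n - m) S w).
by rewrite -iterD subnKC.
Qed.

Lemma range_pow_iter S m n x : range_pow S n x -> range_pow S n (iter m S x).
Proof.
by move=> /range_powE[w ->]; apply/range_powE; exists (iter m S w); rewrite iter_comm.
Qed.

Lemma range_powS S n x : range_pow S n x -> range_pow S n.+1 (S x).
Proof. by move=> /range_powE[w ->]; apply/range_powE; exists w. Qed.

Lemma ker_pow_subspace S d : is_subspace [set x | iter d S x = 0].
Proof.
split=> [|a x y /= x0 y0]; first exact: iter_linear0.
by rewrite iter_linear x0 y0 scaler0 addr0.
Qed.

Lemma ker_pow_closed S L d : 0 <= L -> bounded_by S L ->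
  closed [set x | iter d S x = 0].
Proof.
move=> L0 SL; apply/closed_rnorm => x clx /=; apply: rnorm_le0.
apply/ler_addgt0Pr => e e0; rewrite add0r.
have Ld0 : 0 < L ^+ d + 1 by rewrite ltr_wpDl ?exprn_ge0.
have [a /= a0 xa] := clx (e / (L ^+ d + 1)) (divr_gt0 e0 Ld0).
rewrite -[iter d S x]subr0 -a0 -iter_linearB.
apply: (le_trans (bounded_by_iter _ _ _ L0 SL _)).
by move: xa; rewrite ltr_pdivlMr// => xa; have := rnorm_ge0 (x - a); lra.
Qed.

(** For mu <> 0 the operator S is invertible on N((S - mu)^n), as
S = mu + (S - mu) with S - mu nilpotent there: hence N((S - mu)^n) is contained
in every R(S^m). *)
Lemma ker_pow_sub_range S (mu : R[i]) n x : mu != 0 ->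
  iter n (op_sub S mu) x = 0 -> forall m, range_pow S m x.
Proof.
move=> mu0; elim: n x => [|n IH] x.
  by move=> /= -> m; have [] := range_pow_subspace S m.
rewrite iterSr => /IH Bx; elim=> [|m IHm]; first by apply/range_powE; exists x.
have -> : x = mu^-1 *: (S x - op_sub S mu x).
  by rewrite op_subE subKr scalerA mulVf// scale1r.
have sR := range_pow_subspace S m.+1.
by apply: is_subspaceZ => //; apply: is_subspaceB => //; exact: range_powS.
Qed.

(** The same fact with the roles exchanged: S - mu is invertible on N(S^n). *)
Lemma ker_pow_range_sub S (mu : R[i]) n x : mu != 0 ->
  iter n S x = 0 -> exists u, op_sub S mu u = x.
Proof.
move=> mu0; elim: n x => [|n IH] x.
  by move=> x0; exists 0; rewrite op_subE (linear0 S) scaler0 subr0 -x0.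
rewrite iterSr => /IH[u Bu]; exists (mu^-1 *: (u - x)).
rewrite linearZ (linearB (op_sub S mu)) Bu op_subE subKr.
by rewrite /= scalerA mulVf// scale1r.
Qed.

(** The elements of X that represent, modulo N(S^d), the hyperrange of the
operator induced by S on X / N(S^d). *)
Definition hyperrange_preim S d : set X :=
  [set x | forall n, range_pow S n (iter d S x)].

(** The vanishing of all k_n with n >= d, telescoped into a single condition. *)
Definition uniform_descent S d :=
  forall n x, range_pow S d x -> S x = 0 -> range_pow S n x.

Lemma hyperrange_preim_subspace S d : is_subspace (hyperrange_preim S d).
Proof.
split=> [n|a x y cx cy n]; have [R0 Rl] := range_pow_subspace S n.
  by rewrite iter_linear0.
by rewrite iter_linear; exact: Rl.
Qed.

Lemma hyperrange_preim_mod S d x y :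
  iter d S (x - y) = 0 -> hyperrange_preim S d x -> hyperrange_preim S d y.
Proof. by rewrite iter_linearB => /subr0_eq xy cx n; rewrite -xy. Qed.

(** If S^(d+1) x = S^(n+d+1) w, then S^d x and S^(n+d) w differ by an element of
R(S^d) killed by S, which uniform descent places in R(S^n). *)
Lemma hyperrange_preim_of_image S d x : uniform_descent S d ->
  hyperrange_preim S d (S x) -> hyperrange_preim S d x.
Proof.
move=> uS cSx n; have /range_powE[w] := cSx (n + d).+1.
rewrite -iterSr !iterS => Sxw.
have : range_pow S n (iter d S (x - iter n S w)).
  apply: uS; first by apply/range_powE; eexists.
  by rewrite iter_linearB -iterD addnC (linearB S) Sxw subrr.
rewrite iter_linearB => h; rewrite -(subrK (iter d S (iter n S w)) (iter d S x)).
have sR := range_pow_subspace S n; apply: is_subspaceD => //.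
by apply/range_pow_iter/range_powE; exists w.
Qed.

Lemma hyperrange_preim_of_iter S d n x : uniform_descent S d ->
  hyperrange_preim S d (iter n S x) -> hyperrange_preim S d x.
Proof.
by move=> uS; elim: n => // n IH; rewrite iterS => /hyperrange_preim_of_image-/(_ uS)/IH.
Qed.

Lemma ker_pow_hyperrange_preim S d x : iter d S x = 0 -> hyperrange_preim S d x.
Proof. by move=> x0 n; rewrite x0; have [] := range_pow_subspace S n. Qed.

Lemma range_pow_stable S n : range_pow S n = range_pow S n.+1 ->
  forall m x, range_pow S n x -> range_pow S m x.
Proof.
move=> nS m x nx; have [mn|/ltnW nm] := leqP m n; first exact: range_pow_le nx.
rewrite -(subnKC nm); elim: (m - n)%N => [|k IH]; first by rewrite addn0.
have /range_powE[w xw] := IH.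
have : range_pow S n.+1 (iter n S w) by rewrite -nS; apply/range_powE; exists w.
move=> /range_powE[v wv]; apply/range_powE; exists v.
rewrite xw addnC iterD wv -iterD; congr (iter _ S v).
by rewrite !addnS addnC.
Qed.

(** S^n x is in the hyperrange once the ranges are stationary from n on, and
preimages of the hyperrange stay in it. *)
Lemma hyperrange_full_of_descent S d n : uniform_descent S d ->
  range_pow S n = range_pow S n.+1 -> forall x, hyperrange_preim S d x.
Proof.
move=> uS nS x; apply: (hyperrange_preim_of_iter _ _ n) => // m.
apply: (range_pow_stable S n) => //; apply/range_pow_iter/range_powE.
by exists x.
Qed.

Lemma range_pow_eq_of_hyperrange_full S d : (forall x, hyperrange_preim S d x) ->
  range_pow S d = range_pow S d.+1.
Proof.
move=> cS; apply/seteqP; split; last exact/range_pow_le.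
by move=> _ /range_powE[w ->]; exact: cS.
Qed.

End IteratedOperator.

(** * Perturbation by a small scalar *)

Section PuncturedNeighbourhood.
Context {R : realType} {X : completeNormedModType R[i]}.
Implicit Types (S : {linear X -> X}) (x y : X) (d : nat) (mu : R[i]).

Definition in_range_sub_mod S d mu x := exists u, iter d S (x - op_sub S mu u) = 0.

(** The conclusion of the open mapping theorem for the operator induced by S on
X / N(S^d); [C] bounds the reciprocal of its reduced minimum modulus. *)
Definition lifting_bound S d (C : R) :=
  0 <= C /\ forall x, (exists u, iter d S (x - S u) = 0) ->
    exists2 u, iter d S (x - S u) = 0 & rnorm u <= C * rnorm x.

Variables (S : {linear X -> X}) (L C : R) (d : nat).
Hypothesis L0 : 0 <= L.
Hypothesis SL : bounded_by S L.
Hypothesis uS : uniform_descent S d.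
Hypothesis SC : lifting_bound S d C.

(** Lift x to u with S u = x modulo N(S^d): then x - (S - mu) u = mu u is small
and is again in the hyperrange, so successive approximation applies. *)
Lemma solve_hyperrange_preim mu x : 2 * C * rnorm mu <= 1 -> hyperrange_preim S d x ->
  exists2 u, iter d S (x - op_sub S mu u) = 0 & rnorm u <= 2 * C * rnorm x.
Proof.
move=> muC; have [C0 SCl] := SC.
apply: (successive_approximation (op_sub S mu) (L + rnorm mu) C
  (hyperrange_preim S d) [set x | iter d S x = 0]) => //.
- by rewrite addr_ge0// rnorm_ge0.
- exact: bounded_by_op_sub.
- exact: ker_pow_closed SL.
- exact: ker_pow_subspace.
move=> {}x cx; have /range_powE[w xw] := cx d.+1.
have [|u xu ux] := SCl x.
  by exists w; rewrite iter_linearB xw iterSr subrr.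
exists u, (mu *: u); split => //.
- apply: (is_subspaceZ _ mu u (hyperrange_preim_subspace S d)).
  by apply: hyperrange_preim_of_image => //; exact: hyperrange_preim_mod cx.
- by rewrite /= opprB addrA subrK.
- rewrite rnormZ; have := rnorm_ge0 x; have := rnorm_ge0 mu; nra.
Qed.

(** Since S x = y + mu x, lift y + mu x to a small x'.  Then k = x - x' is killed
by S^(d+1), so it lies in the hyperrange and k = (S - mu) u is solvable with
u of size at most 2C|k|.  The element k + mu u is in the kernel of S - mu, and
subtracting it from x leaves x' - mu u.  All equations are modulo N(S^d). *)
Lemma preimage_halving mu x y : 8 * C * rnorm mu <= 1 ->
  iter d S (y - op_sub S mu x) = 0 ->
  exists2 u, iter d S (y - op_sub S mu u) = 0 &
    rnorm u <= 2 * C * rnorm y + rnorm x / 2.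
Proof.
move=> muC yx; have [C0 SCl] := SC; have mu0 := rnorm_ge0 mu.
have [|x' yx' x'y] := SCl (y + mu *: x).
  by exists x; rewrite -addrA -opprB -op_subE.
pose k := x - x'.
have ck : hyperrange_preim S d k.
  apply/hyperrange_preim_of_image/ker_pow_hyperrange_preim => //; rewrite /k (linearB S).
  rewrite (_ : _ - _ = (y + mu *: x - S x') - (y - op_sub S mu x)).
    by rewrite iter_linearB yx yx' subrr.
  by rewrite op_subE !opprB !addrA [RHS](ACl (4*3*(1*6)*(2*5))) /= !subrr !addr0.
have [|u ku uk] := solve_hyperrange_preim mu k _ ck; first by nra.
exists (x' - mu *: u).
  rewrite (_ : _ - _ = (y + mu *: x - S x') - mu *: (k - op_sub S mu u)).
    by rewrite iter_linearB iter_linearZ ku yx' scaler0 subrr.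
  rewrite (linearB (op_sub S mu)) (linearZZ (op_sub S mu)) (op_subE _ _ x').
  move: (op_sub S mu u) => b; rewrite /= /k !scalerBr !opprD !opprK !addrA.
  by rewrite [RHS](ACl (1*3*(2*4)*5*6)) /= subrr addr0.
have := rnormB x' (mu *: u); rewrite rnormZ => h; apply: (le_trans h).
have {}x'y : rnorm x' <= C * (rnorm y + rnorm mu * rnorm x).
  by apply: (le_trans x'y); rewrite ler_wpM2l// -rnormZ rnormD.
have kx : rnorm k <= rnorm x + rnorm x' by exact: rnormB.
have Cx : C * rnorm mu * rnorm x <= rnorm x / 8.
  by have := rnorm_ge0 x; nra.
have Cy : 0 <= C * rnorm y by rewrite mulr_ge0// rnorm_ge0.
have muk : rnorm mu * rnorm u <= rnorm k / 4.
  apply: (le_trans (ler_wpM2l mu0 uk)); have := rnorm_ge0 k; nra.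
by have := rnorm_ge0 x; lra.
Qed.

(** The bound depends on mu only through the smallness condition: this is what
allows mu to tend to 0. *)
Lemma preimage_bound mu x y : 8 * C * rnorm mu <= 1 ->
  iter d S (y - op_sub S mu x) = 0 ->
  exists2 u, iter d S (y - op_sub S mu u) = 0 & rnorm u <= 4 * C * rnorm y + 1.
Proof.
move=> muC yx.
have H n : exists2 u, iter d S (y - op_sub S mu u) = 0 &
    rnorm u <= 4 * C * rnorm y + rnorm x * 2^-1 ^+ n.
  elim: n => [|n [v yv vy]].
    have [C0 _] := SC; exists x => //; rewrite expr0 mulr1 lerDr.
    by rewrite !mulr_ge0// rnorm_ge0.
  have [u yu uy] := preimage_halving mu v y muC yv; exists u => //.
  by rewrite exprS; lra.
have [n xn] := half_pow_small (rnorm x) 1 ltr01.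
by have [u yu uy] := H n; exists u => //; lra.
Qed.

(** For y near x with y = (S - mu) v modulo N(S^d), a bounded solution u gives
y + mu u = S u modulo N(S^d), and y + mu u is near x because u stays bounded as
mu tends to 0. *)
Lemma onto_of_dense :
  closed [set x | exists u, iter d S (x - S u) = 0] ->
  (forall e, 0 < e -> exists2 mu, rnorm mu < e & forall x e', 0 < e' ->
    exists2 y, in_range_sub_mod S d mu y & rnorm (x - y) < e') ->
  forall x, exists u, iter d S (x - S u) = 0.
Proof.
move=> /closed_rnorm cM dn x; apply: cM => e e0; have [C0 _] := SC.
set K := 4 * C * (rnorm x + 1) + 1.
have K0 : 0 < K by rewrite ltr_wpDl// !mulr_ge0// addr_ge0// rnorm_ge0.
have C8 : 0 < 8 * C + 1 by rewrite ltr_wpDl// mulr_ge0.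
(* [K] bounds the preimages uniformly, so that mu times a preimage is at most
   [e / 2]. *)
have [|mu] := dn (Num.min (8 * C + 1)^-1 (e / (2 * K))).
  by rewrite lt_min invr_gt0 C8 divr_gt0// mulr_gt0.
rewrite lt_min -(mul1r (_^-1)) !ltr_pdivlMr ?mulr_gt0// => /andP[muC muK] dmu.
have [|y [v yv] xy] := dmu x (Num.min 1 (e / 2)).
  by rewrite lt_min ltr01 divr_gt0.
move: xy; rewrite lt_min => /andP[xy1 xye].
have mu0 := rnorm_ge0 mu.
have [|u yu uy] := preimage_bound mu v y _ yv; first by lra.
have yx : rnorm y <= rnorm x + 1.
  have := rdist_triangle x y 0; rewrite !subr0 rdistC; lra.
have uK : rnorm u <= K.
  by apply: (le_trans uy); rewrite lerD2r ler_wpM2l// mulr_ge0.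
exists (y + mu *: u).
  by exists u; move: yu; rewrite op_subE opprB addrA addrAC.
rewrite opprD addrA; apply: (le_lt_trans (rnormB _ _)); rewrite rnormZ.
have := ler_wpM2l mu0 uK; lra.
Qed.

(** From B^n x = B^(n+1) z for B = S - mu, the element x - B z is in N(B^n), hence
in the hyperrange as mu <> 0, and there B can be solved. *)
Lemma onto_mod_of_descent mu n : mu != 0 -> 2 * C * rnorm mu <= 1 ->
  range_pow (op_sub S mu) n = range_pow (op_sub S mu) n.+1 ->
  forall x, in_range_sub_mod S d mu x.
Proof.
move=> mu0 muC nB x; have : range_pow (op_sub S mu) n.+1 (iter n (op_sub S mu) x).
  by rewrite -nB; apply/range_powE; exists x.
move=> /range_powE[z xz]; have cv : hyperrange_preim S d (x - op_sub S mu z).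
  move=> m; apply/range_pow_iter/(ker_pow_sub_range S mu n) => //.
  by rewrite iter_linearB xz iterSr subrr.
have [u xzu _] := solve_hyperrange_preim mu _ muC cv; exists (z + u).
by rewrite (linearD (op_sub S mu)) opprD addrA.
Qed.

(** S - mu reaches every x up to an error in N(S^d), and its range contains
N(S^d) as mu <> 0. *)
Lemma onto_of_hyperrange_full mu : mu != 0 -> 2 * C * rnorm mu <= 1 ->
  (forall x, hyperrange_preim S d x) -> forall x, exists u, op_sub S mu u = x.
Proof.
move=> mu0 muC cS x; have [u xu _] := solve_hyperrange_preim mu x muC (cS x).
have [v Bv] := ker_pow_range_sub S mu d _ mu0 xu; exists (u + v).
by rewrite (linearD (op_sub S mu)) Bv addrC subrK.
Qed.

End PuncturedNeighbourhood.

(** * Dimension, descent and the operator range topology *)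

Section SpectralNotions.
Context {R : realType} {X : normedModType R[i]}.
Implicit Types (S T : {linear X -> X}) (n m d : nat).

Lemma dim_quot_eq0 (A B : set X) : is_subspace B -> dim_quot A B = 0%E -> A `<=` B.
Proof.
move=> sB AB0 x Ax; apply: contrapT => nBx.
have : (1%:R%:E <= dim_quot A B)%E.
  apply: ereal_sup_ubound; exists 1%N => //; exists (fun=> x); split => // c.
  rewrite big_ord1 => Bcx i; rewrite ord1; apply/eqP/negPn/negP => c0; apply: nBx.
  rewrite -[x]scale1r -(mulVf c0) -scalerA; exact: is_subspaceZ.
by rewrite AB0 lee_fin ler10.
Qed.

Lemma uniform_descentP S d : (forall n, (d <= n)%N -> k_ S n = 0%E) ->
  uniform_descent S d.
Proof.
move=> k0 n x dx Sx0; have [nd|/ltnW dn] := leqP n d; first exact: range_pow_le dx.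
rewrite -(subnKC dn); elim: (n - d)%N => [|j IH]; first by rewrite addn0.
rewrite addnS; have sB : is_subspace (range_pow S (d + j).+1 `&` null_space S).
  have [R0 Rl] := range_pow_subspace S (d + j).+1.
  split=> [|a u v [ru su] [rv sv]]; first by split => //; exact: linear0.
  by split; [exact: Rl|rewrite /null_space /= linearP su sv scaler0 addr0].
by have [] := dim_quot_eq0 _ _ sB (k0 _ (leq_addr j d)) x (conj IH Sx0).
Qed.

Lemma op_range_norm_le S d x : op_range_norm S d (iter d S x) <= rnorm x.
Proof.
apply: ge_inf; last by exists x.
by exists 0 => _ [y _ <-]; exact: rnorm_ge0.
Qed.

(** S^d is a contraction from X onto R(S^d) with its operator range norm, so it
pulls closed sets back to closed sets. *)
Lemma preim_op_range_closed S d n : op_range_closed S d (range_pow S n) ->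
  closed [set x | range_pow S n (iter d S x)].
Proof.
move=> cR; apply/closed_rnorm => x clx /=; apply: contrapT => nx.
have [|e e0 eR] := cR (iter d S x) _ nx; first by apply/range_powE; exists x.
have [a /= na xa] := clx e e0; apply: eR na; first by apply/range_powE; exists a.
rewrite -iter_linearB; apply: le_lt_trans (op_range_norm_le _ _ _) _.
by rewrite rdistC.
Qed.

Lemma range_preimE S d :
  [set x | exists u, iter d S (x - S u) = 0] = [set x | range_pow S d.+1 (iter d S x)].
Proof.
apply/seteqP; split=> x /=.
  move=> [u]; rewrite iter_linearB -iterSr => /subr0_eq xu.
  by apply/range_powE; exists u.
by move=> /range_powE[u xu]; exists u; rewrite iter_linearB xu iterSr subrr.
Qed.

Lemma descent_fin S : (descent S < +oo)%E ->
  exists n, descent S = n%:R%:E /\ range_pow S n = range_pow S n.+1.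
Proof.
move=> Sfin; have [n0 Sn0] : exists n, range_pow S n = range_pow S n.+1.
  apply: contrapT => nS; move: Sfin; rewrite /descent.
  have -> : [set n | range_pow S n = range_pow S n.+1] = set0.
    by apply/seteqP; split => // n Sn; apply: nS; exists n.
  by rewrite image_set0 ereal_inf0 ltxx.
have ex : exists n, `[< range_pow S n = range_pow S n.+1 >] by exists n0; apply/asboolP.
case: (ex_minnP ex) => n /asboolP Sn' nmin; exists n; split => //.
apply/eqP; rewrite eq_le; apply/andP; split.
  by apply: ereal_inf_lbound; exists n.
apply: le_ereal_inf_tmp => _ [m Sm <-]; rewrite lee_fin ler_nat; apply: nmin.
exact/asboolP.
Qed.

Lemma descent_lty S n : range_pow S n = range_pow S n.+1 -> (descent S < +oo)%E.
Proof.
move=> Sn; apply: (@le_lt_trans _ _ n%:R%:E); last exact: ltry.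
by apply: ereal_inf_lbound; exists n.
Qed.

Lemma descent_le S n m : descent S = n%:R%:E ->
  range_pow S m = range_pow S m.+1 -> (n <= m)%N.
Proof.
move=> Sn Sm; rewrite -(ler_nat R) -lee_fin -Sn.
by apply: ereal_inf_lbound; exists m.
Qed.

Definition onto S := forall x, exists u, S u = x.

Lemma onto_descent0 S : onto S -> range_pow S 0 = range_pow S 1.
Proof.
move=> oS; apply/seteqP; split => x _; last by exists x.
by have [u <-] := oS x; exists u.
Qed.

Lemma onto_dense S : onto S -> dense (range S).
Proof. by move=> oS O [x Ox] _; exists x; split=> //; have [u <-] := oS x; exists u. Qed.

Lemma onto_lower_semi_Browder S : onto S -> lower_semi_Browder S.
Proof.
move=> oS; split; last exact/descent_lty/onto_descent0.
apply: (@le_lt_trans _ _ 0%E); last exact: ltry.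
apply: ge_ereal_sup => _ [[|n] [v [_ iv]] <-] //.
have [u] := oS (\sum_(i < n.+1) (1 : R[i]) *: v i).
move=> uv; have : (1 : R[i]) = 0 by apply: (iv (fun=> 1) _ ord0); exists u.
by move/eqP; rewrite oner_eq0.
Qed.

Lemma onto_right_Drazin S : onto S -> right_Drazin_invertible S.
Proof.
move=> oS; exists 0%N; split; last first.
  rewrite (_ : range_pow S 0 = setT); first exact: closedT.
  by apply/seteqP; split => // x _; exists x.
have S0 := onto_descent0 _ oS.
have [n [Sn _]] := descent_fin _ (descent_lty _ _ S0).
by have := descent_le _ _ _ Sn S0; rewrite leqn0 Sn => /eqP->.
Qed.
End SpectralNotions.

(** * Accumulation and interior points of plane sets *)

Section Neighbourhoods.
Context {R : realType}.
Implicit Types (A B : set (Cplx R)) (z : Cplx R).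

Lemma interior_limit_point A z : interior A z -> limit_point A z.
Proof.
move=> /nbhs_rnorm [e e0 eA] U /nbhs_rnorm [r r0 rU].
have s0 : 0 < Num.min e r / 2 by rewrite divr_gt0// lt_min e0.
have sN : rnorm ((Num.min e r / 2)%:C%C : R[i]) = Num.min e r / 2.
  by rewrite rnorm_real// ltW.
have mine : Num.min e r <= e by rewrite ge_min lexx.
have minr : Num.min e r <= r by rewrite ge_min lexx orbT.
exists (z + ((Num.min e r / 2)%:C%C : R[i])); split.
- rewrite -subr_eq0 addrAC subrr add0r; apply/eqP => /(congr1 rnorm).
  by rewrite /= sN rnorm0 => s_eq0; move: s0; rewrite s_eq0 ltxx.
- by apply: eA; rewrite addrAC subrr add0r sN; lra.
- by apply: rU; rewrite addrAC subrr add0r sN; lra.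
Qed.

Lemma not_interiorP A z : ~ interior A z ->
  forall e : R, 0 < e -> exists2 w : Cplx R, rnorm (w - z) < e & ~ A w.
Proof.
move=> nA e e0; apply: contrapT => h; apply/nA/nbhs_rnorm; exists e => // w wz.
by apply: contrapT => nAw; apply: h; exists w.
Qed.

Lemma not_limit_point_punctured A z (e : R) : 0 < e ->
  (forall w : Cplx R, w != z -> rnorm (w - z) < e -> ~ A w) -> ~ limit_point A z.
Proof.
move=> e0 eA /(_ [set w | rnorm (w - z) < e]) []; first by apply/nbhs_rnorm; exists e.
by move=> w [wz Aw we]; exact: eA wz we Aw.
Qed.

End Neighbourhoods.

Lemma op_sub_shift {R : realType} {X : normedModType R[i]} (T : {linear X -> X})
    (lambda nu : R[i]) :
  (op_sub T nu : X -> X) = op_sub (op_sub T lambda) (nu - lambda).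
Proof.
by apply/funext => x; rewrite !op_subE scalerBl opprB addrA subrK.
Qed.

Lemma range_pow_shift {R : realType} {X : normedModType R[i]} (T : {linear X -> X})
    (lambda nu : R[i]) n :
  range_pow (op_sub T nu) n = range_pow (op_sub (op_sub T lambda) (nu - lambda)) n.
Proof. by rewrite /range_pow (op_sub_shift T lambda). Qed.

(** * Spectra near a point of topological uniform descent *)

Section TopologicalUniformDescent.
Variables (R : realType) (X : completeNormedModType R[i]) (lambda : Cplx R).
Variables (T : {linear X -> X}) (d : nat).
Hypothesis contT : continuous T.
Hypothesis tudT : TUD (op_sub T lambda) d.
Local Notation S := (op_sub T lambda).

Lemma TUD_uniform_descent : uniform_descent S d.
Proof. by apply: uniform_descentP => n /tudT[]. Qed.

Lemma TUD_closed_preim : closed [set x | exists u, iter d S (x - S u) = 0].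
Proof.
rewrite range_preimE; apply: preim_op_range_closed.
by have [] := tudT _ (leqnSn d).
Qed.

Lemma op_sub_bounded : exists2 L, 0 <= L & bounded_by S L.
Proof.
have [L L0 TL] := continuous_bounded_by _ contT.
exists (L + rnorm (lambda : R[i])); last exact: bounded_by_op_sub.
by rewrite addr_ge0// rnorm_ge0.
Qed.

Lemma TUD_lifting_bound : exists C, lifting_bound S d C.
Proof.
have [L L0 SL] := op_sub_bounded.
have [C C0 SC] := open_mapping_mod S L _ L0 SL (ker_pow_closed S L d L0 SL)
  (ker_pow_subspace S d) TUD_closed_preim.
by exists C.
Qed.

Lemma onto_punctured_neighbourhood : (descent S < +oo)%E -> exists2 e : R, 0 < e &
  forall nu : Cplx R, nu != lambda -> rnorm (nu - lambda) < e -> onto (op_sub T nu).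
Proof.
move=> /descent_fin[n [_ Sn]]; have [L L0 SL] := op_sub_bounded.
have uS := TUD_uniform_descent; have [C SC] := TUD_lifting_bound.
have [C0 _] := SC; have cS := hyperrange_full_of_descent S d n uS Sn.
have C1 : 0 < 2 * C + 1 by rewrite ltr_wpDl// mulr_ge0.
exists (2 * C + 1)^-1; first by rewrite invr_gt0.
move=> nu nul; rewrite -(mul1r (_^-1)) ltr_pdivlMr// => nuC.
rewrite /onto (op_sub_shift T lambda).
apply: (onto_of_hyperrange_full S L C d L0 SL uS SC) => //; first by rewrite subr_eq0.
by have := rnorm_ge0 (nu - lambda); lra.
Qed.

Lemma descent_fin_of_onto_mod :
  (forall e : R, 0 < e -> exists2 nu : Cplx R, rnorm (nu - lambda) < e &
     forall x e', 0 < e' ->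
     exists2 y, in_range_sub_mod S d (nu - lambda) y & rnorm (x - y) < e') ->
  (descent S < +oo)%E.
Proof.
move=> dn; have [L L0 SL] := op_sub_bounded.
have uS := TUD_uniform_descent; have [C SC] := TUD_lifting_bound.
apply: (descent_lty _ d); apply/seteqP; split; last exact/range_pow_le.
move=> _ /range_powE[w ->]; have [|u] := onto_of_dense S L C d L0 SL uS SC
  TUD_closed_preim _ w.
  by move=> e /dn[nu nue nuS]; exists (nu - lambda).
rewrite iter_linearB => /subr0_eq ->; apply/range_powE; exists u.
by rewrite iterSr.
Qed.

Lemma descent_fin_of_sigma_cp : ~ interior (sigma_cp T) lambda -> (descent S < +oo)%E.
Proof.
move=> /not_interiorP ni; apply: descent_fin_of_onto_mod => e /ni[nu nue].
move=> /contrapT/dense_rnorm dn; exists nu => // x e' /(dn x)[_ [u _ <-]] xu.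
exists (op_sub T nu u) => //; exists u.
by rewrite (op_sub_shift T lambda) subrr iter_linear0.
Qed.

(** The points near lambda outside the descent spectrum may reduce to lambda
itself; in that case the conclusion holds trivially, and otherwise the
perturbation argument has mu = nu - lambda different from 0. *)
Lemma descent_fin_of_sigma_dsc : ~ interior (sigma_dsc T) lambda -> (descent S < +oo)%E.
Proof.
move=> /not_interiorP ni.
have [|Soo] := pselect (descent S < +oo)%E; first by [].
have [L L0 SL] := op_sub_bounded; have uS := TUD_uniform_descent.
have [C SC] := TUD_lifting_bound; have [C0 _] := SC.
have C1 : 0 < 2 * C + 1 by rewrite ltr_wpDl// mulr_ge0.
apply: descent_fin_of_onto_mod => e e0.
have [|nu] := ni (Num.min e (2 * C + 1)^-1).
  by rewrite lt_min e0 invr_gt0.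
rewrite lt_min -(mul1r (_^-1)) ltr_pdivlMr// => /andP[nue nuC] nuS.
have nufin : (descent (op_sub T nu) < +oo)%E by rewrite ltey; apply/eqP.
have nul : nu - lambda != 0.
  rewrite subr_eq0; apply/eqP => nul; by apply: Soo; rewrite -nul.
exists nu => // x e' e'0; exists x; last by rewrite subrr rnorm0.
have [n [_ nuSn]] := descent_fin _ nufin.
apply: (onto_mod_of_descent S L C d L0 SL uS SC _ n) => //.
  by have := rnorm_ge0 (nu - lambda); lra.
by rewrite -!range_pow_shift.
Qed.

Lemma not_interior_sub (A B : set (Cplx R)) : A `<=` B ->
  ~ interior B lambda -> ~ interior A lambda.
Proof. by move=> AB nB /(interiorS AB). Qed.

Lemma sigma_dsc_sub_Bminus : sigma_dsc T `<=` sigma_Bminus T.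
Proof. by move=> nu nuoo [_]; rewrite (nuoo : descent _ = _) ltxx. Qed.

Lemma sigma_dsc_sub_RD : sigma_dsc T `<=` sigma_RD T.
Proof. by move=> nu nuoo [n [nun _]]; move: nuoo; rewrite /sigma_dsc /= nun. Qed.

Lemma not_limit_point_of_onto (A : set (Cplx R)) :
  (forall nu, onto (op_sub T nu) -> ~ A nu) ->
  (descent S < +oo)%E -> ~ limit_point A lambda.
Proof.
move=> oA /onto_punctured_neighbourhood[e e0 eo]; apply: not_limit_point_punctured e0 _.
by move=> nu nul nue; apply/oA/eo.
Qed.

Lemma sigma_cp_isolated : (descent S < +oo)%E -> ~ limit_point (sigma_cp T) lambda.
Proof. by apply: not_limit_point_of_onto => nu /onto_dense dn; exact. Qed.

Lemma sigma_Bminus_isolated : (descent S < +oo)%E -> ~ limit_point (sigma_Bminus T) lambda.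
Proof. by apply: not_limit_point_of_onto => nu /onto_lower_semi_Browder dn; exact. Qed.

Lemma sigma_RD_isolated : (descent S < +oo)%E -> ~ limit_point (sigma_RD T) lambda.
Proof. by apply: not_limit_point_of_onto => nu /onto_right_Drazin dn; exact. Qed.

Lemma sigma_dsc_isolated : (descent S < +oo)%E -> ~ limit_point (sigma_dsc T) lambda.
Proof.
apply: not_limit_point_of_onto => nu /onto_descent0/descent_lty + nuoo.
by rewrite (nuoo : descent _ = _) ltxx.
Qed.
End TopologicalUniformDescent.

(** Right Drazin invertibility asks for a closed range at the exact descent n,
while quasi-Fredholmness provides it at m + 1; the ranges agree since they are
already stationary from m on. *)
Lemma right_Drazin_of_quasi_Fredholm {R : realType} {X : normedModType R[i]}
    (S : {linear X -> X}) :
  quasi_Fredholm S -> (descent S < +oo)%E -> right_Drazin_invertible S.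
Proof.
move=> [m [km cm]] /descent_fin[n [Sn nS]]; exists n; split => //.
have Sm : range_pow S m = range_pow S m.+1.
  apply: range_pow_eq_of_hyperrange_full.
  by apply: (hyperrange_full_of_descent S m n _ nS); exact: uniform_descentP.
have stable := range_pow_stable S n nS.
rewrite (_ : range_pow S n = range_pow S m.+1)//; apply/seteqP; split=> x.
  exact: stable.
by rewrite -Sm; apply: range_pow_le; exact: descent_le Sn Sm.
Qed.

Theorem theorem2p15 (R : realType) (X : completeNormedModType R[i])
    (infX : infinite_dimensional X) (lambda : Cplx R)
    (T : {linear X -> X}) (contT : continuous T) (d : nat)
    (tudT : TUD (op_sub T lambda) d) :
  [<-> ~ limit_point (sigma_cp T) lambda;
       ~ (sigma_cp T)° lambda;
       ~ limit_point (sigma_Bminus T) lambda;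
       ~ (sigma_Bminus T)° lambda;
       ~ limit_point (sigma_RD T) lambda;
       ~ (sigma_RD T)° lambda;
       ~ limit_point (sigma_dsc T) lambda;
       ~ (sigma_dsc T)° lambda;
       (descent (op_sub T lambda) < +oo)%E]
  /\
  (quasi_Fredholm (op_sub T lambda) ->
   [<-> ~ limit_point (sigma_cp T) lambda;
        ~ (sigma_cp T)° lambda;
        ~ limit_point (sigma_Bminus T) lambda;
        ~ (sigma_Bminus T)° lambda;
        ~ limit_point (sigma_RD T) lambda;
        ~ (sigma_RD T)° lambda;
        ~ limit_point (sigma_dsc T) lambda;
        ~ (sigma_dsc T)° lambda;
        (descent (op_sub T lambda) < +oo)%E;
        right_Drazin_invertible (op_sub T lambda)]).
Proof.
have iso_cp := sigma_cp_isolated _ _ _ _ _ contT tudT.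
have iso_B := sigma_Bminus_isolated _ _ _ _ _ contT tudT.
have iso_RD := sigma_RD_isolated _ _ _ _ _ contT tudT.
have iso_dsc := sigma_dsc_isolated _ _ _ _ _ contT tudT.
have fin_cp := descent_fin_of_sigma_cp _ _ _ _ _ contT tudT.
have fin_dsc := descent_fin_of_sigma_dsc _ _ _ _ _ contT tudT.
have int A : ~ limit_point A lambda -> ~ interior A lambda.
  by move=> nlA /interior_limit_point.
have dsc_B := not_interior_sub _ lambda _ _ (sigma_dsc_sub_Bminus _ _ T).
have dsc_RD := not_interior_sub _ lambda _ _ (sigma_dsc_sub_RD _ _ T).
split=> [|qF]; tfae; try exact: int.
- by move=> /fin_cp/iso_B.
- by move=> /dsc_B/fin_dsc/iso_RD.
- by move=> /dsc_RD/fin_dsc/iso_dsc.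
- exact: fin_dsc.
- exact: iso_cp.
- by move=> /fin_cp/iso_B.
- by move=> /dsc_B/fin_dsc/iso_RD.
- by move=> /dsc_RD/fin_dsc/iso_dsc.
- exact: fin_dsc.
- exact: right_Drazin_of_quasi_Fredholm.
- by move=> [n [Sn _]]; apply: iso_cp; rewrite Sn ltry.
Qed.
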